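(* Let $u$ be analytic on $\mathbb D$ and let $\varphi:\mathbb D\to\mathbb D$ be analytic, with $u\in\mathcal H(b)$ and $u\varphi\in\mathcal H(b)$. Let $J=\{1\le i\le n:\ u^{(\ell)}(\zeta_i)\neq 0\text{ for some }0\le \ell\le m_i-1,\text{ and }\varphi(\zeta_i)\in\mathbb D\}$ and let $$w=\frac{u\cdot (a\circ\varphi)\cdot\prod_{j\in J}\left(\varphi-\varphi(\zeta_j)\right)^{m_j}}{a}.$$ Assume that $w\in H^2$. Then, for every $1\leq i\leq n$, either $u^{(\ell)}(\zeta_i)=0$ for all $0\leq \ell\leq m_i-1$, or there exists $\ell$ with $0\leq \ell\leq m_i-1$ such that $u^{(\ell)}(\zeta_i)\neq0$, and then $\varphi$ has a non-tangential limit $\varphi(\zeta_i)$ at $\zeta_i$ that satisfies $\varphi(\zeta_i)\in \mathbb{D}\cup Z(a)$, where $Z(a)=\{\zeta_1,\dots,\zeta_n\}$.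
   Context: $\mathbb D$ is the open unit disk, $\mathbb T$ the unit circle; $H^2,H^\infty$ are the Hardy spaces of $\mathbb D$. $b$ is a fixed rational function in the closed unit ball of $H^\infty$ with $\|b\|_\infty=1$ that is not a finite Blaschke product (equivalently, not inner). Its Pythagorean mate $\tilde a$ is the unique outer function with $|\tilde a|^2+|b|^2=1$ a.e. on $\mathbb T$ and $\tilde a(0)>0$; it is rational, without zeros in $\mathbb D$ or poles in $\overline{\mathbb D}$. Its distinct zeros on $\mathbb T$ are $\zeta_1,\dots,\zeta_n$ ($n\ge1$) with multiplicities $m_1,\dots,m_n$; $N=\sum_i m_i$ and $a(z)=\prod_{i=1}^n(z-\zeta_i)^{m_i}$. $\mathcal P_{N-1}$ is the space of polynomials of degree at most $N-1$. The de Branges--Rovnyak space $\mathcal H(b)$ is, as a set, the direct sum $\mathcal H(b)=aH^2\oplus\mathcal P_{N-1}$. For $f\in\mathcal H(b)$, $f$ and its derivatives up to order $m_i-1$ have non-tangential limits at $\zeta_i$, denoted $f^{(k)}(\zeta_i)$. $\varphi(\zeta_i)$ denotes the non-tangential limit of $\varphi$ at $\zeta_i$; when $u,u\varphi\in\mathcal H(b)$, it exists whenever $u^{(\ell)}(\zeta_i)\ne0$ for some $0\le\ell\le m_i-1$, so $w$ is a well-defined analytic function on $\mathbb D$ (an empty product is $1$). *)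

(* Defs.v *)
From HB Require Import structures.
From mathcomp Require Import all_boot all_order all_algebra.
From mathcomp Require Import complex.
From mathcomp Require Import all_classical all_reals all_analysis.

Set Implicit Arguments.
Unset Strict Implicit.
Unset Printing Implicit Defensive.

Import Order.TTheory GRing.Theory Num.Theory.
Import numFieldNormedType.Exports.

Local Open Scope classical_set_scope.
Local Open Scope ring_scope.

Section HardySpaces.
Variable R : realType.
Local Notation C := (R[i]^o).
Local Notation mu := (@lebesgue_measure R).

(** The order on [R[i]] compares only numbers with equal imaginary parts, so
    [`|z| < 1] between complex numbers is the usual inequality of moduli. *)
Definition disk : set C := [set z | `|z| < 1].

(** Real-valued modulus. *)
Definition cmod (z : C) : R := complex.Re `|z|.

Definition cis (t : R) : C := Complex (cos t) (sin t).

Definition cexp (z : C) : C :=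
  (expR (complex.Re z))%:C%C * cis (complex.Im z).

Definition analytic (f : C -> C) : Prop :=
  forall z, disk z -> derivable f z 1.

(** Neighbourhoods of [zeta] for non-tangential approach from [disk]: sets that
    contain, for every aperture [M], all points of the Stolz region
    [|z - zeta| < M (1 - |z|)] that are close enough to [zeta].  Convergence
    along this filter is convergence in every Stolz region at [zeta]. *)
Definition stolz (zeta M : C) : set C :=
  [set z | disk z /\ `|z - zeta| < M * (1 - `|z|)].

Definition nontangential (zeta : C) : set_system C :=
  [set A | forall M : C, within (stolz zeta M) (nbhs zeta) A].

#[global] Instance nontangential_filter (zeta : C) :
  Filter (nontangential zeta).
Proof.
split=> [M|A B nA nB M|A B AB nA M]; first exact: filterT.
- exact: (filterI (nA M) (nB M)).
- exact: (filterS AB (nA M)).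
Qed.

(** Only the values of a function on [disk] matter in the spaces below. *)
Definition hardy2 : set (C -> C) :=
  [set f | exists c : nat -> C,
    (\sum_(0 <= k <oo) ((cmod (c k)) ^+ 2)%:E < +oo)%E /\
    forall z, disk z -> series (fun k => c k * z ^+ k) @ \oo --> f z].

Definition hinf_norm (f : C -> C) : \bar R :=
  ereal_sup [set (cmod (f z))%:E | z in disk].

Definition hardyoo : set (C -> C) :=
  [set f | analytic f /\ (hinf_norm f < +oo)%E].

Definition finite_blaschke (f : C -> C) : Prop :=
  exists (c : C) (s : seq C), [/\ `|c| = 1, {in s, forall w, `|w| < 1} &
    forall z, disk z ->
      f z = c * \prod_(w <- s) ((z - w) / (1 - conjc w * z))].

(** [f] is the rational function [p / q], in lowest terms and without poles in
    [disk]. *)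
Definition rational_on_disk (f : C -> C) (p q : {poly C}) : Prop :=
  coprimep p q /\
  forall z, disk z -> q.[z] != 0 /\ f z = p.[z] / q.[z].

(** Outer functions: [c exp ((1/2pi) \int_0^2pi (e^it+z)/(e^it-z) k(t) dt)]
    with [|c| = 1] and [k] integrable (then [k = ln |f|] a.e. on the circle). *)
Definition herglotz (k : R -> R) (z : C) : C :=
  let F (t : R) : C := (cis t + z) / (cis t - z) * (k t)%:C%C in
  Complex (\int[mu]_(t in `[0, 2 * pi]) complex.Re (F t))%R
          (\int[mu]_(t in `[0, 2 * pi]) complex.Im (F t))%R
  / (2 * pi)%:C%C.

Definition outer (f : C -> C) : Prop :=
  exists (c : C) (k : R -> R), [/\ `|c| = 1,
    mu.-integrable `[0, 2 * pi] (EFin \o k) &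
    forall z, disk z -> f z = c * cexp (herglotz k z)].

(** In the equation [|f|^2 + |b|^2 = 1] a.e. on the circle, the functions are
    identified with their non-tangential boundary values.  The inequality
    [0 < f 0] in [R[i]] says that [f 0] is real and positive. *)
Definition pythagorean_mate (b f : C -> C) : Prop :=
  [/\ outer f, 0 < f 0 &
    {ae mu, forall t : R, exists x y : C,
      [/\ f @ nontangential (cis t) --> x, b @ nontangential (cis t) --> y
        & `|x| ^+ 2 + `|y| ^+ 2 = 1]}].

(** [zeta] enumerates the distinct zeros on the circle of the polynomial [p],
    and [m] gives their multiplicities. *)
Definition circle_zeros (p : {poly C}) (n : nat) (zeta : 'I_n -> C)
    (m : 'I_n -> nat) : Prop :=
  [/\ injective zeta,
      forall z, (`|z| = 1 /\ root p z) <-> (exists i, z = zeta i) &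
      forall i, m i = mup (zeta i) p].

Definition zeros_poly (n : nat) (zeta : 'I_n -> C) (m : 'I_n -> nat) :
    {poly C} :=
  \prod_(i < n) ('X - (zeta i)%:P) ^+ m i.

(** The space [H(b)] of a rational [b] in the closed unit ball of [H^infty]
    that is not inner, as a set: [H(b) = a H^2 + P_(N-1)].  It depends on [b]
    through the boundary zeros [zeta], with multiplicities [m], of the
    Pythagorean mate of [b]; [a] is the monic polynomial with these zeros and
    [N] is its degree. *)
Definition de_branges_rovnyak (n : nat) (zeta : 'I_n -> C) (m : 'I_n -> nat) :
    set (C -> C) :=
  [set f | exists g (p : {poly C}),
    [/\ hardy2 g, (size p <= \sum_(i < n) m i)%N &
      forall z, disk z -> f z = (zeros_poly zeta m).[z] * g z + p.[z]]].

(** [f^(l)(zeta) = 0], resp. [f^(l)(zeta) <> 0], for the non-tangential limit at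
    [zeta] of the [l]-th derivative. *)
Definition bderiv_eq0 (f : C -> C) (l : nat) (zeta : C) : Prop :=
  derive1n l f @ nontangential zeta --> (0 : C).

Definition bderiv_neq0 (f : C -> C) (l : nat) (zeta : C) : Prop :=
  exists2 c : C, derive1n l f @ nontangential zeta --> c & c != 0.

Definition index_J (u phi : C -> C) (n : nat) (zeta : 'I_n -> C)
    (m : 'I_n -> nat) (i : 'I_n) : Prop :=
  (exists2 l : nat, (l < m i)%N & bderiv_neq0 u l (zeta i)) /\
  (exists2 v : C, phi @ nontangential (zeta i) --> v & disk v).

Definition weight_w (u phi : C -> C) (n : nat) (zeta : 'I_n -> C)
    (m : 'I_n -> nat) (z : C) : C :=
  let a := zeros_poly zeta m in
  u z * a.[phi z] *
  (\prod_(j < n | `[< index_J u phi zeta m j >])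
     (phi z - lim (phi @ nontangential (zeta j))) ^+ m j)
  / a.[z].

End HardySpaces.

(* Main.v *)
(** The coefficients of a function [g] in [H^2] tend to [0], so its [j]-th
    derivative is [o((1 - |z|)^-(j+1))], hence [o((z - zeta)^-(j+1))] in every
    Stolz region at [zeta].  By the Leibniz rule the [l]-th derivative of [a g] is
    therefore [o((z - zeta_i)^(m_i - 1 - l))]: writing [u = a g + p], the boundary
    derivatives of [u] of order less than [m_i] are those of [p].  If they do not
    all vanish, let [k < m_i] be the order of [p] at [zeta_i].  Then
    [u / (z - zeta_i)^k] has a nonzero limit, and since [|phi| < 1] the polynomial
    part of [u phi] also vanishes to order [k], so [phi], a quotient of two
    convergent functions, has a limit [v] with [|v| <= 1].  If [|v| = 1] and
    [a(v) <> 0], then [w (z - zeta_i)^(m_i - k)] has a nonzero limit, whereas it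
    tends to [0] because [w] is in [H^2] and [m_i - k >= 1]. *)

Require Import Defs.
From mathcomp Require Import all_boot all_order all_algebra.
From mathcomp Require Import complex.
From mathcomp Require Import all_classical all_reals all_analysis.
From mathcomp Require Import ring zify.

Set Implicit Arguments.
Unset Strict Implicit.
Unset Printing Implicit Defensive.

Import Order.TTheory GRing.Theory Num.Theory.
Import numFieldNormedType.Exports.

Local Open Scope classical_set_scope.
Local Open Scope ring_scope.

(** * Power series with bounded coefficients *)

Section ChooseSums.
Variable F : numFieldType.

(** Multiplying the sum for [j + 1] by [1 - r] telescopes, by Pascal's rule, to the sum for [j]
    minus a nonnegative term. The bound is the value of the full negative binomial series. *)
Lemma sum_choose_expr_le (r : F) (j N : nat) : 0 <= r -> r < 1 ->
  \sum_(0 <= n < N) ('C(n + j, j))%:R * r ^+ n <= (1 - r) ^- j.+1.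
Proof.
move=> r0 r1; have s0 : 0 < 1 - r by rewrite subr_gt0.
elim: j => [|j IH] in N *.
  rewrite expr1 -div1r ler_pdivlMr//.
  under eq_bigr do rewrite addn0 bin0 mul1r.
  have -> : (\sum_(0 <= n < N) r ^+ n) * (1 - r) = 1 - r ^+ N.
    elim: N => [|N IHN]; first by rewrite big_geq// mul0r expr0 subrr.
    by rewrite big_nat_recr//= mulrDl IHN exprS; ring.
  by rewrite lerBlDr lerDl exprn_ge0.
rewrite exprS invfM mulrC ler_pdivlMr//.
apply: le_trans (IH N).
have -> : (\sum_(0 <= n < N) ('C(n + j.+1, j.+1))%:R * r ^+ n) * (1 - r) =
    \sum_(0 <= n < N) ('C(n + j, j))%:R * r ^+ n - ('C(N + j, j.+1))%:R * r ^+ N.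
  elim: N => [|N IHN].
    by rewrite !big_geq// mul0r add0n bin_small// mul0r subrr.
  rewrite !big_nat_recr//= mulrDl IHN !(addnS, addSn) !binS !natrD exprS.
  by ring.
by rewrite lerBlDr lerDl mulr_ge0// exprn_ge0.
Qed.

End ChooseSums.

(** Both sides equal [(n + j + 2)! / (j! 2! n!)]. The identity turns the Taylor remainder of
    [jet c j] into a binomial series of order [j + 2]. *)
Lemma bin_mulC2 (n j : nat) :
  ('C(n.+2 + j, j) * 'C(n.+2, 2) = 'C(n + j.+2, j.+2) * 'C(j.+2, 2))%N.
Proof.
have binD (p q : nat) : ('C(p + q, q) * (q`! * p`!) = (p + q)`!)%N.
  by rewrite -[in p`!](addnK q p) bin_fact ?leq_addl.
have A := binD n.+2 j; have B := binD n 2; have D := binD n j.+2.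
have E := binD j 2; rewrite !addn2 in B E.
have nD : (n.+2 + j = n + j.+2)%N by lia.
apply/eqP; rewrite -(@eqn_pmul2r (j`! * (2`! * n`!)))%N; last first.
  by rewrite !muln_gt0 !fact_gt0.
apply/eqP; transitivity ((n + j.+2)`!)%N.
  by rewrite -nD -A -B; ring.
by rewrite -D -E; ring.
Qed.

Section DiskSeries.
Variable R : realType.
Local Notation C := (R[i]^o).
Implicit Types (c : nat -> C) (z w h : C).

Lemma cvg_norm_le (T : Type) (F : set_system T) (FF : ProperFilter F)
    (f : T -> C) (x B : C) :
  f @ F --> x -> (\forall t \near F, `|f t| <= B) -> `|x| <= B.
Proof.
move=> fx fB; have [t0 ft0] := filter_ex fB.
(* The order on [C] is partial, so negating [<=] requires [B] to be real; a single value of [f]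
   gives [0 <= B]. *)
have B0 : 0 <= B := le_trans (normr_ge0 _) ft0.
rewrite real_leNgt ?ger0_real//; apply/negP => Bx.
have e0 : 0 < `|x| - B by rewrite subr_gt0.
move/cvgrPdist_lt : fx => /(_ _ e0) fx.
have [t [ft]] := filter_ex (filterI fB fx).
rewrite ltrBrDr => xt; suff : `|x| < `|x| by rewrite ltxx.
apply: le_lt_trans xt.
by rewrite -{1}(subrK (f t) x) (le_trans (ler_normD _ _))// lerD2l.
Qed.

Lemma cvg_real_complex (f : nat -> R) (l : R) :
  f @ \oo --> l -> (fun n => (f n)%:C%C : C) @ \oo --> (l%:C%C : C).
Proof.
move=> fl; apply/cvgrPdist_lt => -[e e'] /=; rewrite ltcE /= => /andP[/eqP -> e0].
move/cvgrPdist_lt : fl => /(_ _ e0); apply: filterS => n.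
by rewrite -rmorphB /= normc_def /= expr0n addr0 sqrtr_sqr ltcR.
Qed.

(** The real parts of [c n] and of [- 'i * c n], the latter being the imaginary parts of [c n], give
    real series dominated by the moduli; the two limits then recombine. *)
Lemma abs_series_is_cvg c (B : C) :
  (forall N, \sum_(0 <= n < N) `|c n| <= B) -> cvgn (series c).
Proof.
have Re_sum (a : nat -> C) N : \sum_(0 <= n < N) complex.Re (a n) =
    complex.Re (\sum_(0 <= n < N) a n).
  by apply/esym/(@big_morph _ _ (@complex.Re R)) => // -[? ?] [? ?].
have Re_cvg (a : nat -> C) : (forall N, \sum_(0 <= n < N) `|a n| <= B) ->
    cvgn (series (fun n => complex.Re (a n))).
  move=> aB.
  have Re_le (z : C) : `|complex.Re z| <= complex.Re `|z|.
    by have := normc_ge_Re z; rewrite lecE => /andP[].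
  apply: normed_cvg.
  apply: (@series_le_cvg _ _ (fun n => complex.Re `|a n|)) => [n|n|n|].
  - exact: normr_ge0.
  - exact: le_trans (normr_ge0 _) (Re_le (a n)).
  - exact: Re_le.
  apply: nondecreasing_is_cvgn.
    by apply: nondecreasing_series => n _ _; exact: le_trans (normr_ge0 _) (Re_le (a n)).
  exists (complex.Re B) => _ [N _ <-] /=; rewrite /series /= (Re_sum (fun n => `|a n|)).
  by have := aB N; rewrite lecE => /andP[_].
move=> cB.
have /cvg_real_complex reC := Re_cvg c cB.
have /cvg_real_complex imC : cvgn (series (fun n => complex.Re (- 'i%C * c n))).
  apply: Re_cvg => N; under eq_bigr do
    rewrite normrM normrN normc_def /= expr0n expr1n add0r sqrtr1 mul1r.
  exact: cB.
have := cvgD reC (cvgM (cvg_cst ('i%C : C)) imC).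
set l := (X in _ --> X); set f := (X in X @ _ --> _) => H.
have fE : f = series c; last by rewrite -fE; apply/cvg_ex; exists l; exact: H.
apply/funext => N; rewrite /f !fctE.
rewrite /series /= !Re_sum -mulr_sumr.
move: (\sum_(0 <= n < N) c n) => [x y]; apply/eqP; rewrite eq_complex /=.
by apply/andP; split; apply/eqP; ring.
Qed.

End DiskSeries.

(** * Taylor estimates and derivatives of power series *)

Section PowerSeriesJets.
Variable R : realType.
Local Notation C := (R[i]^o).
Implicit Types (c : nat -> C) (z w h : C) (K B e : C).

(** Passing from [n] to [n + 1] multiplies the remainder by [z + h] and adds [n + 2] times
    [h ^+ 2 * z ^+ n.+1]; Pascal's rule combines the two coefficients. *)
Lemma expr_taylor1_le z h (rho : C) (n : nat) : `|z| <= rho -> `|z + h| <= rho ->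
  `|(z + h) ^+ n.+2 - z ^+ n.+2 - h * (z ^+ n.+1 *+ n.+2)| <=
  ('C(n.+2, 2))%:R * `|h| ^+ 2 * rho ^+ n.
Proof.
move=> zr zhr; have r0 : 0 <= rho := le_trans (normr_ge0 _) zr.
elim: n => [|n IH].
  have -> : (z + h) ^+ 2 - z ^+ 2 - h * (z ^+ 1 *+ 2) = h ^+ 2 by ring.
  by rewrite normrX expr0 mulr1 binn mul1r.
have -> : (z + h) ^+ n.+3 - z ^+ n.+3 - h * (z ^+ n.+2 *+ n.+3) =
    (z + h) * ((z + h) ^+ n.+2 - z ^+ n.+2 - h * (z ^+ n.+1 *+ n.+2)) +
    h ^+ 2 * (z ^+ n.+1 *+ n.+2).
  by rewrite (exprS (z + h) n.+2) (exprS z n.+2) (exprS z n.+1); ring.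
rewrite (le_trans (ler_normD _ _))// binS bin1 natrD.
  rewrite -mulrA [leRHS]mulrDl lerD//.
  by rewrite normrM (exprS rho) mulrA [leRHS]mulrCA ler_pM.
rewrite normrM normrX normrMn normrX -(mulr_natl (`|z| ^+ _)) [leRHS]mulrCA.
by rewrite ler_wpM2l ?exprn_ge0// ler_wpM2l// lerXn2r ?nnegrE.
Qed.

Definition jet_coef c (j : nat) : nat -> C := fun n => c (n + j)%N *+ 'C(n + j, j).

Definition jet_term c (j : nat) z : nat -> C := fun n => jet_coef c j n * z ^+ n.

(** [1 / j!] times the [j]-th derivative of the sum of [c n * z ^+ n]. *)
Definition jet c (j : nat) z : C := lim (series (jet_term c j z) @ \oo).

Lemma sum_jet_term_le c j z K N : (forall n, `|c n| <= K) -> `|z| < 1 ->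
  \sum_(0 <= n < N) `|jet_term c j z n| <= K * (1 - `|z|) ^- j.+1.
Proof.
move=> cK z1; have K0 : 0 <= K := le_trans (normr_ge0 _) (cK 0%N).
apply: (@le_trans _ _ (\sum_(0 <= n < N) K * (('C(n + j, j))%:R * `|z| ^+ n))).
  apply: ler_sum => n _; rewrite normrM normrMn normrX -(mulr_natl `|c _|) mulrCA mulrA.
  by rewrite ler_wpM2r ?exprn_ge0// ler_wpM2l.
by rewrite -mulr_sumr ler_wpM2l// sum_choose_expr_le.
Qed.

Lemma jet_cvg c j z K : (forall n, `|c n| <= K) -> `|z| < 1 ->
  series (jet_term c j z) @ \oo --> jet c j z.
Proof.
move=> cK z1; apply: (@abs_series_is_cvg _ _ (K * (1 - `|z|) ^- j.+1)) => N.
exact: sum_jet_term_le.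
Qed.

Lemma is_derive_quadratic (f : C -> C) z (d B : C) (e : C) : 0 < e ->
  (forall h, `|h| < e -> `|f (z + h) - f z - h * d| <= B * `|h| ^+ 2) ->
  is_derive z 1 f d.
Proof.
move=> e0 fd.
(* The sign of [B] follows from the hypothesis at [h = e / 2]. *)
have B0 : 0 <= B.
  have e20 : 0 < `|e / 2| by rewrite normr_gt0 mulf_neq0 ?invr_eq0 ?pnatr_eq0// gt_eqF.
  rewrite -(@pmulr_lge0 _ (`|e / 2| ^+ 2)) ?exprn_gt0//.
  apply: le_trans (fd (e / 2) _); first exact: normr_ge0.
  by rewrite gtr0_norm ?divr_gt0// ltr_pdivrMr// mulr_natr mulr2n ltrDl.
have H : h^-1 *: ((f \o shift z) (h *: 1) - f z) @[h --> (0 : C)^'] --> d.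
  apply/cvgrPdist_le => eps eps0.
  near=> h.
  have h0 : h != 0 by near: h; apply: filterS (nbhs_dnbhs_neq (0 : C)) => x.
  have -> : d - h^-1 *: ((f \o shift z) (h *: 1) - f z) =
      - (h^-1 * (f (z + h) - f z - h * d)).
    rewrite /= (_ : h *: 1 = h); last exact: mulr1.
    rewrite [h + z]addrC -[h^-1 *: _]/(h^-1 * _).
    by rewrite [in RHS]mulrBr mulrA mulVf// mul1r opprB.
  rewrite normrN normrM normfV ler_pdivrMl ?normr_gt0//.
  have he : `|h| < e by near: h; exact: (@dnbhs0_lt _ C).
  apply: le_trans (fd h he) _.
  rewrite expr2 mulrCA ler_wpM2l//.
  (* [B + 1] replaces [B] in order to divide by a positive number. *)
  rewrite (@le_trans _ _ ((B + 1) * `|h|))// ?ler_wpM2r ?lerDl//.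
  rewrite mulrC -ler_pdivlMr ?ltr_wpDl//.
  by near: h; apply: (@dnbhs0_le _ C); rewrite divr_gt0 ?ltr_wpDl.
apply: DeriveDef; first by apply/cvg_ex; exists d.
exact: cvg_lim H.
Unshelve. all: by end_near. Qed.

End PowerSeriesJets.

Section JetDerivative.
Variable R : realType.
Local Notation C := (R[i]^o).
Implicit Types (c : nat -> C) (z w h : C) (K B e : C).

(** Coefficient form of the rule that [jet c j] has derivative [j + 1] times [jet c j.+1]. *)
Lemma jet_coefS c (j n : nat) :
  jet_coef c j n.+1 *+ n.+1 = j.+1%:R * jet_coef c j.+1 n.
Proof.
rewrite /jet_coef mulr_natl -!mulrnA addnS -addSn; congr (_ *+ _).
by rewrite [RHS]mulnC mul_bin_left addnK mulnC.
Qed.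

Lemma jet_taylor1_le c (j : nat) (K : C) z h (rho : C) : (forall n, `|c n| <= K) ->
  `|z| <= rho -> `|z + h| <= rho -> rho < 1 ->
  `|jet c j (z + h) - jet c j z - h * (j.+1%:R * jet c j.+1 z)| <=
  K * ('C(j.+2, 2))%:R * (1 - rho) ^- j.+3 * `|h| ^+ 2.
Proof.
move=> cK zr zhr r1.
have K0 : 0 <= K := le_trans (normr_ge0 _) (cK 0%N).
have r0 : 0 <= rho := le_trans (normr_ge0 _) zr.
(* Differentiation lowers the degree by one, whence [M + 2] terms against [M + 1]. The terms of
   degree 0 and 1 then cancel, which leaves [M] remainders of degree at least 2. *)
pose S (x : C) M := series (jet_term c j x) M.+2.
pose S' M := series (jet_term c j.+1 z) M.+1.
apply: (@cvg_norm_le _ _ \oo _ (fun M => S (z + h) M - S z M - h * (j.+1%:R * S' M))).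
  apply: cvgB; first apply: cvgB.
  - have := @jet_cvg _ c j (z + h) _ cK (le_lt_trans zhr r1).
    by rewrite -(@cvg_shiftn 2); under eq_fun do rewrite addn2.
  - have := @jet_cvg _ c j z _ cK (le_lt_trans zr r1).
    by rewrite -(@cvg_shiftn 2); under eq_fun do rewrite addn2.
  - apply: cvgM; first exact: cvg_cst.
    apply: cvgM; first exact: cvg_cst.
    have := @jet_cvg _ c j.+1 z _ cK (le_lt_trans zr r1).
    by rewrite -(@cvg_shiftn 1); under eq_fun do rewrite addn1.
apply: nearW => M.
have -> : S (z + h) M - S z M - h * (j.+1%:R * S' M) =
  \sum_(0 <= n < M) jet_coef c j n.+2 *
     ((z + h) ^+ n.+2 - z ^+ n.+2 - h * (z ^+ n.+1 *+ n.+2)).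
  rewrite /S /S' /series /=; elim: M => [|M IH].
    rewrite !big_nat_recr//= !big_geq// /jet_term.
    by have := jet_coefS c j 0; rewrite mulr1n => ->; ring.
  rewrite [RHS]big_nat_recr//= -IH (big_nat_recr M.+1)//= !(big_nat_recr M.+2)//=.
  have := jet_coefS c j M.+1; rewrite /jet_term -(mulr_natr (jet_coef _ _ _)) => jS.
  rewrite [in RHS]mulrBr mulrBr.
  have -> : jet_coef c j M.+2 * (h * (z ^+ M.+1 *+ M.+2)) =
      h * z ^+ M.+1 * (jet_coef c j M.+2 * M.+2%:R) by ring.
  by rewrite jS; ring.
apply: le_trans (ler_norm_sum _ _ _) _.
apply: (@le_trans _ _ (\sum_(0 <= n < M) K * ('C(j.+2, 2))%:R * `|h| ^+ 2 *
    (('C(n + j.+2, j.+2))%:R * rho ^+ n))).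
  apply: ler_sum => n _; rewrite normrM normrMn -(mulr_natl `|c _|).
  have cn : ('C(n.+2 + j, j))%:R * `|c (n.+2 + j)%N| <= ('C(n.+2 + j, j))%:R * K.
    by apply: ler_wpM2l => //; exact: cK.
  apply: le_trans (ler_pM _ _ cn (expr_taylor1_le n zr zhr)) _ => //.
  rewrite le_eqVlt; apply/orP; left; apply/eqP.
  transitivity (K * `|h| ^+ 2 * rho ^+ n * ('C(n.+2 + j, j) * 'C(n.+2, 2))%:R).
    by rewrite natrM; ring.
  by rewrite bin_mulC2 natrM; ring.
rewrite -mulr_sumr [leRHS]mulrAC ler_wpM2l ?sum_choose_expr_le//.
by rewrite !mulr_ge0 ?exprn_ge0.
Qed.

Lemma is_derive_jet c j z K : (forall n, `|c n| <= K) -> `|z| < 1 ->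
  is_derive z 1 (jet c j) (j.+1%:R * jet c j.+1 z).
Proof.
(* The midpoint [rho] of [|z|] and [1] bounds [|z|] and [|z + h|] as long as
   [|h| < (1 - |z|) / 2]. *)
move=> cK z1; pose rho : C := (1 + `|z|) / 2.
have s0 : 0 < 1 - `|z| by rewrite subr_gt0.
have e0 : 0 < (1 - `|z|) / 2 by rewrite divr_gt0.
have rhoE : rho = `|z| + (1 - `|z|) / 2 by rewrite /rho; field.
have rho1 : rho < 1.
  have -> : rho = 1 - (1 - `|z|) / 2 by rewrite /rho; field.
  by rewrite ltrBlDr ltrDl.
apply: (@is_derive_quadratic _ _ _ _ (K * ('C(j.+2, 2))%:R * (1 - rho) ^- j.+3)
  ((1 - `|z|) / 2)) => // h he.
apply: jet_taylor1_le => //; first by rewrite rhoE lerDl ltW.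
by rewrite (le_trans (ler_normD _ _))// rhoE lerD2l ltW.
Qed.

(** Abel-type estimate: the finitely many coefficients exceeding [e] contribute
    a bounded amount. *)
Lemma jet_le c j z K e (N : nat) : (forall n, `|c n| <= K) -> 0 <= e ->
  (forall n, (N <= n)%N -> `|c n| <= e) -> `|z| < 1 ->
  `|jet c j z| <=
  \sum_(0 <= n < N) K * ('C(n + j, j))%:R + e * (1 - `|z|) ^- j.+1.
Proof.
move=> cK e0 cN z1; have K0 : 0 <= K := le_trans (normr_ge0 _) (cK 0%N).
apply: cvg_norm_le (jet_cvg cK z1) _; apply: nearW => M.
rewrite /series /= (le_trans (ler_norm_sum _ _ _))//.
apply: (@le_trans _ _ (\sum_(0 <= n < M) (if (n < N)%N then K * ('C(n + j, j))%:R else 0) +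
   \sum_(0 <= n < M) e * (('C(n + j, j))%:R * `|z| ^+ n))).
  rewrite -big_split /=; apply: ler_sum => n _.
  rewrite normrM normrMn normrX -(mulr_natl `|c _|).
  have [nN|Nn] := ltnP n N.
    rewrite (@le_trans _ _ (K * ('C(n + j, j))%:R))// ?lerDl ?mulr_ge0 ?exprn_ge0//.
    rewrite -[leRHS]mulr1 ler_pM ?mulr_ge0 ?exprn_ge0//; last by rewrite exprn_ile1// ltW.
    by rewrite mulrC ler_wpM2r.
  rewrite add0r mulrCA mulrA ler_wpM2r ?exprn_ge0// ler_wpM2l// cN//.
  by rewrite (leq_trans Nn)// leq_addr.
apply: lerD; last by rewrite -mulr_sumr ler_wpM2l// sum_choose_expr_le.
pose F n := if (n < N)%N then K * ('C(n + j, j))%:R else 0.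
rewrite -/(F _).
have F0 n : 0 <= F n by rewrite /F; case: ifP => // _; rewrite mulr_ge0.
(* Summing up to [N + M] treats [M <= N] and [N <= M] together. *)
apply: (@le_trans _ _ (\sum_(0 <= n < N + M) F n)).
  rewrite addnC (@big_cat_nat _ _ _ M 0 (M + N)) ?leq_addr//= lerDl.
  by apply: sumr_ge0 => n _.
rewrite (@big_cat_nat _ _ _ N 0 (N + M)) ?leq_addr//= [X in _ + X]big1_seq ?addr0.
  rewrite le_eqVlt; apply/orP; left; apply/eqP.
  by apply: eq_big_nat => n /andP[_ nN]; rewrite /F nN.
by move=> n /andP[_]; rewrite mem_index_iota /F => /andP[Nn _]; rewrite ltnNge Nn.
Qed.

End JetDerivative.

(** * Non-tangential limits *)

Section Nontangential.
Variable R : realType.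
Local Notation C := (R[i]^o).
Implicit Types (c : nat -> C) (z w h zeta : C) (K B e : C).

Lemma cvg_mul0 (T : Type) (F : set_system T) (FF : Filter F) (f g : T -> C) (b : C) :
  f @ F --> (0 : C) -> g @ F --> b -> f x * g x @[x --> F] --> (0 : C).
Proof.
move=> f0 gb; have := @cvgM _ _ F FF f g 0 b f0 gb.
by rewrite mul0r.
Qed.

Lemma near_nontangential_disk zeta : \forall z \near nontangential zeta, disk z.
Proof. by move=> M; apply: filterS (withinT (stolz zeta M) _) => z []. Qed.

Lemma cvg_nontangential_id zeta : z @[z --> nontangential zeta] --> zeta.
Proof. by move=> A zA M; apply: filterS zA => z Az _. Qed.

Lemma cvg_nontangential_subX zeta k :
  (z - zeta) ^+ k.+1 @[z --> nontangential zeta] --> (0 : C).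
Proof.
have sub0 : z - zeta @[z --> nontangential zeta] --> (0 : C).
  rewrite -(subrr zeta); apply: cvgB; last exact: cvg_cst.
  exact: cvg_nontangential_id.
elim: k => [|k IH]; first by under eq_fun do rewrite expr1.
under eq_fun do rewrite exprS.
exact: cvg_mul0 IH.
Qed.

Lemma disk_neq zeta z : `|zeta| = 1 -> disk z -> z - zeta != 0.
Proof.
move=> zeta1 zd; rewrite subr_eq0; apply/eqP => zz; move: zd.
by rewrite /disk /= zz zeta1 ltxx.
Qed.

(** The radial points [z = (1 - d) * zeta] lie in the Stolz region of aperture [2], since
    [|z - zeta|] and [1 - |z|] both equal [d]. *)
Lemma nontangential_proper zeta : `|zeta| = 1 -> ProperFilter (nontangential zeta).
Proof.
move=> zeta1; apply: Build_ProperFilter_ex => A /(_ 2) /nbhs_ballP[e /= e0 eA].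
pose d : C := Num.min (e / 2) (1 / 2).
have dE : d = e / 2 \/ d = 1 / 2 by rewrite /d /Num.min; case: ifP; [left|right].
have dle : d <= e / 2 /\ d <= 1 / 2.
  by split; rewrite ?ge_min ?lexx ?orbT// comparable_ge_min ?lexx ?orbT//;
    apply: real_comparable; rewrite ger0_real ?divr_ge0// ltW.
have d0 : 0 < d by case: dE => ->; rewrite divr_gt0.
have d1 : d < 1 by rewrite (le_lt_trans dle.2)// ltr_pdivrMr// mul1r ltr1n.
have de : d < e by rewrite (le_lt_trans dle.1)// ltr_pdivrMr// mulr_natr mulr2n ltrDl.
have zE : (1 - d) * zeta - zeta = - (d * zeta) by ring.
have nz : `|(1 - d) * zeta| = 1 - d.
  by rewrite normrM zeta1 mulr1 ger0_norm// subr_ge0 ltW.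
exists ((1 - d) * zeta); apply: eA.
  rewrite -ball_normE /ball_ /= -opprB zE opprK normrM zeta1 mulr1.
  by rewrite gtr0_norm.
split; first by rewrite /disk /= nz ltrBlDr ltrDl.
rewrite zE normrN normrM zeta1 mulr1 nz gtr0_norm// opprB addrCA subrr addr0.
by rewrite mulrC mulr_natr mulr2n ltrDl.
Qed.

Lemma cvg0_bounded c : c @ \oo --> (0 : C) -> exists K, forall n, `|c n| <= K.
Proof.
move=> c0; have /cvgr0Pnorm_le/(_ 1 ltr01)[N _ cN] := c0.
exists (1 + \sum_(0 <= n < N) `|c n|) => n.
have [nN|Nn] := ltnP n N; last first.
  by rewrite (le_trans (cN n Nn))// lerDl sumr_ge0.
rewrite (bigD1_seq n) ?mem_index_iota ?iota_uniq//= addrCA lerDl.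
by rewrite addr_ge0 ?sumr_ge0.
Qed.

(** In the bound of [jet_le], the constant part is killed by [(z - zeta) ^+ j.+1]. In the other part
    the ratio [|z - zeta| / (1 - |z|)] stays below the aperture while the tail coefficients are
    small. *)
Lemma cvg_jet_nontangential c (j : nat) zeta : c @ \oo --> (0 : C) ->
  jet c j z * (z - zeta) ^+ j.+1 @[z --> nontangential zeta] --> (0 : C).
Proof.
move=> c0.
have [K cK] := cvg0_bounded c0.
apply/cvgr0Pnorm_le => e e0 M.
have e20 : 0 < e / 2 by rewrite divr_gt0.
(* The aperture [M] is fixed before the cut-off [N], so the threshold for the coefficients may
   depend on it; adding [1] keeps [m] positive. *)
pose m : C := `|M| ^+ j.+1 + 1.
have m0 : 0 < m by rewrite ltr_wpDl ?exprn_ge0.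
have /cvgr0Pnorm_le/(_ (e / 2 / m) (divr_gt0 e20 m0))[N _ cN] := c0.
pose S : C := \sum_(0 <= n < N) K * ('C(n + j, j))%:R.
have : (z - zeta) ^+ j.+1 * S @[z --> nontangential zeta] --> (0 : C).
  exact: cvg_mul0 (@cvg_nontangential_subX zeta j) (cvg_cst S).
move=> /cvgr0Pnorm_le/(_ _ e20)/(_ M) near_S.
have K0 : 0 <= K := le_trans (normr_ge0 _) (cK 0%N).
have S0 : 0 <= S by apply: sumr_ge0 => n _; rewrite mulr_ge0.
apply: filterS2 near_S (withinT (stolz zeta M) _) => z Sz [z1 zM].
rewrite /disk /= in z1; have := Sz; rewrite /= normrM (ger0_norm S0) mulrC => {}Sz.
have s0 : 0 < 1 - `|z| by rewrite subr_gt0.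
have jle := jet_le j cK (ltW (divr_gt0 e20 m0)) cN z1.
rewrite normrM; apply: le_trans (ler_wpM2r (normr_ge0 _) jle) _.
rewrite mulrDl [leRHS]splitr lerD// normrX.
rewrite -[leLHS]mulrA -[leRHS](@mulfVK _ m) ?gt_eqF// ler_pM2l ?divr_gt0//.
rewrite mulrC -expr_div_n.
apply: (@le_trans _ _ (`|M| ^+ j.+1)); last by rewrite lerDl.
(* [M] is an arbitrary complex number; a point in its Stolz region forces [0 < M]. *)
have M0 : 0 < M by rewrite -(pmulr_lgt0 _ s0) (le_lt_trans _ zM).
rewrite lerXn2r ?nnegrE ?divr_ge0// ?(ltW s0)// ler_pdivrMr// (gtr0_norm M0).
exact: ltW.
Qed.

End Nontangential.

(** * Growth of derivatives at a boundary point *)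

Section Flatness.
Variable R : realType.
Local Notation C := (R[i]^o).
Implicit Types (f g : C -> C) (z w zeta : C) (G : nat -> C -> C).

Lemma near_disk z : disk z -> \forall y \near z, disk y.
Proof.
rewrite /disk /= => zd; have s0 : 0 < 1 - `|z| by rewrite subr_gt0.
apply/nbhs_ballP; exists (1 - `|z|) => // y; rewrite -ball_normE /ball_ /= => zy.
rewrite -(subrK z y) (le_lt_trans (ler_normD _ _))// -ltrBrDr distrC.
exact: zy.
Qed.

Lemma eq_disk_cvg f g zeta (l : C) : (forall z, disk z -> f z = g z) ->
  f @ nontangential zeta --> l -> g @ nontangential zeta --> l.
Proof.
move=> fg fl; apply: cvg_trans fl; apply: near_eq_cvg.
have := near_nontangential_disk zeta; apply: filterS => z zd; exact: fg.
Qed.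

(** An explicit sequence of derivatives lets sums and products be handled by formulas;
    [derive1n_tower] returns to iterated derivatives. *)
Definition derivative_tower f G : Prop :=
  (forall z, disk z -> f z = G 0%N z) /\
  (forall j z, disk z -> is_derive z 1 (G j) (G j.+1 z)).

Lemma derive1n_tower f G j z : derivative_tower f G -> disk z ->
  derive1n j f z = G j z.
Proof.
move=> [f0 dG]; elim: j z => [|j IH] z zd; first exact: f0.
rewrite derive1nS derive1E (@near_eq_derive _ _ _ _ (G j)); last first.
  by apply: filterS (near_disk zd) => y /IH.
exact: (@derive_val _ _ _ _ _ _ _ (dG j z zd)).
Qed.

(** [flat zeta e f]: the derivatives of [f] are [o((z - zeta) ^ (e - 1 - j))]. *)
Definition flat zeta (e : nat) f : Prop := exists G, derivative_tower f G /\
  forall j, G j z * (z - zeta) ^+ j.+1 / (z - zeta) ^+ e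
    @[z --> nontangential zeta] --> (0 : C).

Lemma coef_cvg0 (c : nat -> C) :
  (\sum_(0 <= k <oo) ((cmod (c k)) ^+ 2)%:E < +oo)%E -> c @ \oo --> (0 : C).
Proof.
move=> cfin; pose a k : R := cmod (c k) ^+ 2.
have a0 k : 0 <= a k by exact: sqr_ge0.
have /cvg_series_cvg_0 : cvgn (series a).
  apply: nondecreasing_is_cvgn; first exact: nondecreasing_series.
  exists (fine (\sum_(0 <= k <oo) (a k)%:E)%E) => _ [N _ <-].
  rewrite -lee_fin fineK; last first.
    by rewrite ge0_fin_numE ?nneseries_ge0// => k _ _; rewrite lee_fin.
  by rewrite /series /= -sumEFin; apply: nneseries_lim_ge => k _; rewrite lee_fin.
move=> /cvgr0Pnorm_lt a_lt; apply/cvgr0Pnorm_lt => -[e e'].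
rewrite ltcE /= => /andP[/eqP -> e0].
apply: filterS (a_lt (e ^+ 2) (exprn_gt0 _ e0)) => k.
rewrite ger0_norm// /a ltr_sqr ?nnegrE ?(ltW e0)//; last first.
  by have := normr_ge0 (c k); rewrite lecE => /andP[].
move=> ck; rewrite ltcE [complex.Re _]/= ck andbT normc_def.
by rewrite /= eqxx.
Qed.

(** Square summability makes the coefficients tend to [0], so [cvg_jet_nontangential] applies; the
    factor [j!] undoes the normalization of [jet]. *)
Lemma hardy2_flat zeta f : hardy2 f -> flat zeta 0 f.
Proof.
move=> [c [/coef_cvg0 c0 fc]].
have [K cK] := cvg0_bounded c0.
exists (fun j z => j`!%:R * jet c j z); split; first split.
- move=> z zd; rewrite mul1r.
  have cE : jet_term c 0 z = (fun k => c k * z ^+ k).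
    by apply/funext => k; rewrite /jet_term /jet_coef addn0 bin0 mulr1n.
  have := @jet_cvg _ c 0 z K cK zd; rewrite cE => jc.
  exact: (@norm_cvg_unique _ C _ _ _ _ (fc z zd) jc).
- move=> j z zd.
  have H : is_derive z 1 (fun y => j`!%:R * jet c j y) (j`!%:R * (j.+1%:R * jet c j.+1 z)).
    exact: (is_deriveZ (j`!%:R : C) (is_derive_jet j cK zd)).
  apply: (is_derive_eq H); rewrite factS natrM.
  by rewrite mulrA [_%:R * _%:R]mulrC.
- move=> j; apply: (@eq_disk_cvg (fun z => jet c j z * (z - zeta) ^+ j.+1 * j`!%:R)).
    by move=> z _; rewrite expr0 divr1; ring.
  apply: cvg_mul0; last exact: cvg_cst.
  exact: cvg_jet_nontangential.
Qed.

(** Leibniz rule for [(z - w) * f]; at [j = 0] the junk value [G 0.-1] has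
    coefficient [0]. *)
Definition tower_mul w G : nat -> C -> C :=
  fun j z => (z - w) * G j z + j%:R * G j.-1 z.

Lemma derivative_tower_mul w f G : derivative_tower f G ->
  derivative_tower (fun z => (z - w) * f z) (tower_mul w G).
Proof.
move=> [f0 dG]; split=> [z zd|j z zd].
  by rewrite /tower_mul mul0r addr0 f0.
have D1 : is_derive z (1 : C) (id - cst w) (1 - 0).
  exact: is_deriveB.
have D2 := is_deriveM D1 (dG j z zd).
case: j D2 => [|j] D2.
  rewrite (_ : tower_mul w G 0 = (id - cst w) * G 0%N); last first.
    by apply/funext => y; rewrite /tower_mul mul0r addr0.
  apply: (is_derive_eq D2); rewrite /tower_mul /GRing.scale /= subr0 mulr1 mul1r.
  by [].
have D3 := is_deriveD D2 (is_deriveZ (j.+1%:R : C) (dG j z zd)).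
rewrite (_ : tower_mul w G j.+1 = (id - cst w) * G j.+1 + j.+1%:R \*: G j)//.
apply: (is_derive_eq D3); rewrite /tower_mul /GRing.scale /= subr0 mulr1.
rewrite -[(id - cst w) z]/(z - w) -[j.+2]addn1 natrD.
by ring.
Qed.

(** The Leibniz term in [G j.-1] has a spare factor [z - zeta], so it is negligible as well. *)
Lemma flat_mul zeta e w f : flat zeta e f -> flat zeta e (fun z => (z - w) * f z).
Proof.
move=> [G [fG G0]]; exists (tower_mul w G); split; first exact: derivative_tower_mul.
have sub_cvg x : z - x @[z --> nontangential zeta] --> zeta - x.
  by apply: cvgB; [exact: cvg_nontangential_id|exact: cvg_cst].
move=> j; pose T k z := G k z * (z - zeta) ^+ k.+1 / (z - zeta) ^+ e.
apply: (@eq_disk_cvg (fun z => T j z * (z - w) + T j.-1 z * ((z - zeta) * j%:R))).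
  by move=> z _; rewrite /T /tower_mul; case: j => [|j] /=; rewrite ?exprS; ring.
rewrite -(addr0 0); apply: cvgD.
  exact: cvg_mul0 (G0 j) (sub_cvg w).
apply: cvg_mul0 (G0 j.-1) _.
by apply: cvgM; [exact: sub_cvg|exact: cvg_cst].
Qed.

(** For [w = zeta] both Leibniz terms gain a power: the first through the new factor, the second
    because its derivative has lower order. *)
Lemma flat_mulS zeta e f : `|zeta| = 1 -> flat zeta e f ->
  flat zeta e.+1 (fun z => (z - zeta) * f z).
Proof.
move=> zeta1 [G [fG G0]]; exists (tower_mul zeta G); split.
  exact: derivative_tower_mul.
move=> j; pose T k z := G k z * (z - zeta) ^+ k.+1 / (z - zeta) ^+ e.
apply: (@eq_disk_cvg (fun z => T j z + T j.-1 z * j%:R)).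
  move=> z /(disk_neq zeta1) z0; rewrite /T /tower_mul.
  by case: j => [|j] /=; rewrite ?exprS; field; rewrite ?expf_neq0 ?z0.
rewrite -(addr0 0); apply: cvgD; first exact: G0.
by apply: cvg_mul0 (G0 j.-1) _; exact: cvg_cst.
Qed.

End Flatness.

(** * Boundary limits of a flat function plus a polynomial *)

Section BoundaryBehaviour.
Variable R : realType.
Local Notation C := (R[i]^o).
Implicit Types (f g F : C -> C) (z w zeta v : C) (p q : {poly C}).

Lemma horner_cvg (T : Type) (Fi : set_system T) (FF : Filter Fi) (h : T -> C) v q :
  h @ Fi --> v -> q.[h x] @[x --> Fi] --> q.[v].
Proof.
move=> hv; elim/poly_ind: q => [|q c IH].
  by under eq_fun do rewrite horner0; rewrite horner0; exact: cvg_cst.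
under eq_fun do rewrite hornerMXaddC; rewrite hornerMXaddC.
have IHM := cvgM IH hv.
exact: (@cvgD _ C _ Fi FF _ (fun=> c) _ c (IHM FF) (cvg_cst c)).
Qed.

Lemma horner_nontangential zeta q :
  q.[z] @[z --> nontangential zeta] --> q.[zeta].
Proof. by apply: horner_cvg; exact: cvg_nontangential_id. Qed.

Lemma is_derive_horner q z : is_derive z (1 : C) (horner q) q^`().[z].
Proof.
elim/poly_ind: q => [|q c IH].
  rewrite deriv0 horner0 (_ : horner 0 = cst 0); first exact: is_derive_cst.
  by apply/funext => x; rewrite horner0.
rewrite (_ : horner _ = (fun x => q.[x] * x) + cst c); last first.
  by apply/funext => x; rewrite hornerMXaddC.
have D := is_deriveD (is_deriveM IH (is_derive_id z 1)) (is_derive_cst c z 1).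
apply: (is_derive_eq D); rewrite derivMXaddC hornerD hornerM hornerX.
by rewrite addr0 /GRing.scale /= mulr1 [z * _]mulrC.
Qed.

Lemma flat_poly zeta e f q : (exists s : seq C, q = \prod_(w <- s) ('X - w%:P)) ->
  flat zeta e f -> flat zeta e (fun z => q.[z] * f z).
Proof.
move=> [s ->] ff; elim: s => [|w s IH].
  rewrite big_nil (_ : (fun _ => _) = f)//.
  by apply/funext => z; rewrite hornerC mul1r.
rewrite big_cons; have := flat_mul w IH; congr flat.
by apply/funext => z; rewrite hornerM hornerXsubC mulrA.
Qed.

Lemma flat_mulX zeta e k f : `|zeta| = 1 -> flat zeta e f ->
  flat zeta (k + e) (fun z => (z - zeta) ^+ k * f z).
Proof.
move=> zeta1 ff; elim: k => [|k IH].
  rewrite (_ : (fun _ => _) = f)//.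
  by apply/funext => z; rewrite expr0 mul1r.
have := flat_mulS zeta1 IH; congr flat.
by apply/funext => z; rewrite exprS mulrA.
Qed.

(** The quotient is the level [0] expression in [flat] times [(z - zeta) ^+ (e - k.+1)], a
    polynomial because [k < e]. *)
Lemma flat_cvg0 zeta e k F : `|zeta| = 1 -> (k < e)%N -> flat zeta e F ->
  F z / (z - zeta) ^+ k @[z --> nontangential zeta] --> (0 : C).
Proof.
move=> zeta1 ke [G [[F0 _] /(_ 0%N) G0]].
apply: (@eq_disk_cvg _ (fun z => G 0%N z * (z - zeta) ^+ 1 / (z - zeta) ^+ e *
    (('X - zeta%:P) ^+ (e - k.+1)).[z])); last first.
  by apply: cvg_mul0 G0 _; exact: horner_nontangential.
move=> z zd; rewrite -F0// expr1 horner_exp hornerXsubC.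
have := disk_neq zeta1 zd; set x := z - zeta => x0.
by rewrite -[in X in _ / X](subnK ke) exprD exprS; field; rewrite !expf_neq0// x0.
Qed.

Lemma flat_add_poly_cvg zeta e k F q : `|zeta| = 1 -> (k < e)%N -> flat zeta e F ->
  (F z + (q * ('X - zeta%:P) ^+ k).[z]) / (z - zeta) ^+ k
    @[z --> nontangential zeta] --> q.[zeta].
Proof.
move=> zeta1 ke ff.
apply: (@eq_disk_cvg _ (fun z => F z / (z - zeta) ^+ k + q.[z])); last first.
  rewrite -[X in _ --> X]add0r.
  by apply: cvgD (flat_cvg0 zeta1 ke ff) _; exact: horner_nontangential.
move=> z zd; rewrite hornerM horner_exp hornerXsubC.
by have := disk_neq zeta1 zd; set x := z - zeta => x0; field; rewrite expf_neq0.
Qed.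

(** The towers of [F] and [p] add up, and the first tends to [0] at each level below [e]. This reads
    the boundary derivatives of a function in [H(b)] off its polynomial part. *)
Lemma derive1n_flat_add_poly_cvg zeta e l f F p : `|zeta| = 1 -> (l < e)%N ->
  flat zeta e F -> (forall z, disk z -> f z = F z + p.[z]) ->
  derive1n l f @ nontangential zeta --> p^`(l).[zeta].
Proof.
move=> zeta1 le [G [[F0 dG] G0]] fE.
have tow : derivative_tower f (fun j z => G j z + p^`(j).[z]).
  split=> [z zd|j z zd]; first by rewrite fE// F0.
  have := is_deriveD (dG j z zd) (is_derive_horner p^`(j) z).
  by rewrite -derivnS.
have H : (G l z + p^`(l).[z]) @[z --> nontangential zeta] --> 0 + p^`(l).[zeta].
  apply: cvgD; last exact: horner_nontangential.
  apply: (@eq_disk_cvg _ (fun z => G l z * (z - zeta) ^+ l.+1 / (z - zeta) ^+ e *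
      (('X - zeta%:P) ^+ (e - l.+1)).[z])); last first.
    by apply: cvg_mul0 (G0 l) _; exact: horner_nontangential.
  move=> z zd; rewrite horner_exp hornerXsubC.
  have := disk_neq zeta1 zd; set x := z - zeta => x0.
  by rewrite -[in X in _ / X](subnK le) exprD; field; rewrite !expf_neq0// x0.
rewrite add0r in H; apply: eq_disk_cvg H => z zd.
by rewrite (derive1n_tower l tow zd).
Qed.

End BoundaryBehaviour.

(** Each derivative removes one factor ['X - c%:P] and multiplies the value of the cofactor at [c]
    by the current exponent, whence [k!]. *)
Lemma horner_derivn_mulXsubC (A : comNzRingType) (c : A) (k l : nat) (q : {poly A}) :
  (l <= k)%N ->
  (q * ('X - c%:P) ^+ k)^`(l).[c] = if l == k then k`!%:R * q.[c] else 0.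
Proof.
elim: l k q => [|l IH] k q lk.
  rewrite derivn0 hornerM horner_exp hornerXsubC subrr expr0n.
  by case: k {lk} => [|k] /=; rewrite ?mulr1 ?mul1r ?mulr0.
case: k lk => // k lk; rewrite derivSn.
have -> : (q * ('X - c%:P) ^+ k.+1)^`() =
    (q^`() * ('X - c%:P) + q *+ k.+1) * ('X - c%:P) ^+ k.
  by rewrite derivM deriv_exp derivXsubC mul1r exprS /=; ring.
rewrite IH// eqSS hornerD hornerM hornerXsubC subrr mulr0 add0r hornerMn.
by case: eqP => // _; rewrite factS natrM -mulr_natl; ring.
Qed.

(** * The space [H(b)] near one zero of [a] *)

Section DeBrangesRovnyak.
Variable R : realType.
Local Notation C := (R[i]^o).
Variables (n : nat) (zeta : 'I_n -> C) (m : 'I_n -> nat).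
Hypotheses (zeta_inj : injective zeta) (zeta1 : forall i, `|zeta i| = 1).

Definition zeros_cofactor (i : 'I_n) : {poly C} :=
  \prod_(j < n | j != i) ('X - (zeta j)%:P) ^+ m j.

Lemma zeros_polyE i :
  zeros_poly zeta m = ('X - (zeta i)%:P) ^+ m i * zeros_cofactor i.
Proof. by rewrite /zeros_poly (bigD1 i). Qed.

Lemma zeros_cofactor_neq0 i : (zeros_cofactor i).[zeta i] != 0.
Proof.
rewrite /zeros_cofactor horner_prod; apply/prodf_neq0 => j ji.
rewrite horner_exp hornerXsubC expf_neq0// subr_eq0.
by apply: contraNneq ji => /zeta_inj ->.
Qed.

Lemma zeros_poly_eq0 z : (zeros_poly zeta m).[z] = 0 -> exists j, z = zeta j.
Proof.
rewrite /zeros_poly horner_prod => /eqP; rewrite prodf_seq_eq0 => /hasP[j _ /=].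
rewrite horner_exp hornerXsubC expf_eq0 subr_eq0 => /andP[_ /eqP ->].
by exists j.
Qed.

Lemma flat_zeros_cofactor i e f : flat (zeta i) e f ->
  flat (zeta i) e (fun z => (zeros_cofactor i).[z] * f z).
Proof.
apply: flat_poly; rewrite /zeros_cofactor.
elim/big_ind : _ => [|_ _ [s ->] [t ->]|j _].
- by exists [::]; rewrite big_nil.
- by exists (s ++ t); rewrite big_cat.
- by exists (nseq (m j) (zeta j)); rewrite big_nseq iter_mulr_1.
Qed.

(** The factor in [H^2] is flat of order [0]; the factors of [a] at the other zeros preserve this
    order, and the one at [zeta i] raises it to [m i]. *)
Lemma de_branges_rovnyak_flat i f : de_branges_rovnyak zeta m f ->
  exists F p, flat (zeta i) (m i) F /\ forall z, disk z -> f z = F z + p.[z].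
Proof.
move=> [g [p [/(@hardy2_flat _ (zeta i)) gf _ fE]]].
exists (fun z => (zeros_poly zeta m).[z] * g z), p; split=> //.
have := flat_mulX (m i) (zeta1 i) (flat_zeros_cofactor gf).
rewrite addn0; congr flat; apply/funext => z.
by rewrite (zeros_polyE i) hornerM horner_exp hornerXsubC mulrA.
Qed.

End DeBrangesRovnyak.

(** * The limit of [phi] *)

Section LimitOfPhi.
Variable R : realType.
Local Notation C := (R[i]^o).
Implicit Types (f g F phi : C -> C) (z w zeta v : C) (p q : {poly C}).

Lemma cvg_nontangential_unique zeta f (l1 l2 : C) : `|zeta| = 1 ->
  f @ nontangential zeta --> l1 -> f @ nontangential zeta --> l2 -> l1 = l2.
Proof.
move=> /nontangential_proper proper fl1 fl2.
exact: (@norm_cvg_unique _ C _ _ _ _ fl1 fl2).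
Qed.

Lemma cvg0_mul_bounded zeta f phi : (forall z, disk z -> disk (phi z)) ->
  f @ nontangential zeta --> (0 : C) ->
  f z * phi z @[z --> nontangential zeta] --> (0 : C).
Proof.
move=> phi_disk /cvgr0Pnorm_le f0; apply/cvgr0Pnorm_le => eps eps0.
apply: filterS2 (near_nontangential_disk zeta) (f0 eps eps0) => z zd fz.
rewrite normrM -[leRHS]mulr1 ler_pM//.
exact: ltW (phi_disk z zd).
Qed.

(** If [p] had order [l < k] at [zeta], dividing the equation by [(z - zeta) ^+ l] would give a
    nonzero limit on the right but the limit [0] on the left, where [phi] is bounded. *)
Lemma bounded_quotient_poly_factor zeta e k F q H p phi : `|zeta| = 1 -> (k < e)%N ->
  (forall z, disk z -> disk (phi z)) ->
  flat zeta e F -> flat zeta e H ->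
  (forall z, disk z ->
    (F z + (q * ('X - zeta%:P) ^+ k).[z]) * phi z = H z + p.[z]) ->
  exists q', p = q' * ('X - zeta%:P) ^+ k.
Proof.
move=> zeta1 ke phi_disk flatF flatH FH.
have [l [q' q'0 pE]] := multiplicity_XsubC p zeta.
have [p0|p0] := eqVneq p 0; first by exists 0; rewrite p0 mul0r.
have [kl|lk] := leqP k l.
  by exists (q' * ('X - zeta%:P) ^+ (l - k)); rewrite -mulrA -exprD subnK.
exfalso; move: q'0; rewrite p0 /= => /negP; apply.
have Hl := flat_add_poly_cvg (q := q') zeta1 (ltn_trans lk ke) flatH.
have Fk := flat_add_poly_cvg (q := q) zeta1 ke flatF.
rewrite /root; apply/eqP/(cvg_nontangential_unique zeta1 Hl).
(* The exponent is [k - l], written as a successor to fit [cvg_nontangential_subX]. *)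
apply: (@eq_disk_cvg _ (fun z => (z - zeta) ^+ (k - l.+1).+1 *
    ((F z + (q * ('X - zeta%:P) ^+ k).[z]) / (z - zeta) ^+ k) * phi z)).
  move=> z zd; rewrite -pE -FH// subnSK//.
  have := disk_neq zeta1 zd; set x := z - zeta => x0.
  by rewrite -[in X in _ / X](subnK (ltnW lk)) exprD; field; rewrite !expf_neq0.
have sub0 := @cvg_nontangential_subX R zeta (k - l.+1).
exact: (cvg0_mul_bounded phi_disk (cvg_mul0 _ sub0 Fk)).
Qed.

End LimitOfPhi.

Section Limits.
Variable R : realType.
Local Notation C := (R[i]^o).
Implicit Types (f g F u phi : C -> C) (z w zeta v : C) (p q : {poly C}).

(** Both sides of the equation can be divided by [(z - zeta) ^+ k], so near [zeta] the function
    [phi] is a quotient of functions with limits [q'.[zeta]] and [q.[zeta]], the latter nonzero. *)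
Lemma bounded_quotient_limit zeta e k F q H p phi : `|zeta| = 1 -> (k < e)%N ->
  (forall z, disk z -> disk (phi z)) ->
  flat zeta e F -> flat zeta e H -> q.[zeta] != 0 ->
  (forall z, disk z ->
    (F z + (q * ('X - zeta%:P) ^+ k).[z]) * phi z = H z + p.[z]) ->
  exists2 v, phi @ nontangential zeta --> v & `|v| <= 1.
Proof.
move=> zeta1 ke phi_disk flatF flatH q0 FH.
have [q' pE] := bounded_quotient_poly_factor zeta1 ke phi_disk flatF flatH FH.
have Fk := flat_add_poly_cvg (q := q) zeta1 ke flatF.
have Hk := flat_add_poly_cvg (q := q') zeta1 ke flatH.
pose U z := (F z + (q * ('X - zeta%:P) ^+ k).[z]) / (z - zeta) ^+ k.
have U0 : \forall z \near nontangential zeta, U z != 0 by exact: cvgr_neq0 Fk q0.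
have phi_cvg : phi @ nontangential zeta --> q'.[zeta] * (q.[zeta])^-1.
  have HU : (H z + (q' * ('X - zeta%:P) ^+ k).[z]) / (z - zeta) ^+ k * (U z)^-1
      @[z --> nontangential zeta] --> q'.[zeta] * (q.[zeta])^-1.
    exact: cvgM Hk (cvgV q0 Fk).
  apply: cvg_trans HU; apply: near_eq_cvg.
  apply: filterS2 (near_nontangential_disk zeta) U0 => z zd Uz /=.
  move: Uz; rewrite -pE -FH// /U; set num := _ + _; set den := _ ^+ k.
  by rewrite mulf_eq0 invr_eq0 negb_or => /andP[num0 den0]; field; rewrite ?num0 ?den0.
exists (q'.[zeta] * (q.[zeta])^-1) => //.
have proper := nontangential_proper zeta1.
apply: cvg_norm_le phi_cvg _; apply: filterS (near_nontangential_disk zeta) => z zd.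
exact: ltW (phi_disk z zd).
Qed.

Lemma nontangential_lim zeta phi v : `|zeta| = 1 ->
  phi @ nontangential zeta --> v -> lim (phi @ nontangential zeta) = v.
Proof. by move=> /nontangential_proper proper; exact: norm_cvg_lim. Qed.

(** * The weight [w] near one zero of [a] *)

Section Weight.
Variables (n : nat) (zeta : 'I_n -> C) (m : 'I_n -> nat) (u phi : C -> C).
Hypotheses (zeta_inj : injective zeta) (zeta1 : forall i, `|zeta i| = 1).

(** The numerator of [w] is [u] times [Q] composed with [phi], so a limit [v] of [phi] yields the
    limit [Q.[v]]. *)
Let Q : {poly C} := zeros_poly zeta m * \prod_(j < n | `[< index_J u phi zeta m j >])
  ('X - (lim (phi @ nontangential (zeta j)))%:P) ^+ m j.

(** Of the [m i] powers of [z - zeta i] in the denominator, [k] are assigned to [u] and the others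
    cancel; each factor on the right then has a limit when [u] has order [k] and [phi] converges. *)
Lemma weight_wE i k z : (k < m i)%N -> disk z ->
  weight_w u phi zeta m z * (z - zeta i) ^+ (m i - k) =
  u z / (z - zeta i) ^+ k * (Q.[phi z] / (zeros_cofactor zeta m i).[z]).
Proof.
move=> km zd; rewrite /weight_w [in X in _ / X](zeros_polyE zeta m i).
have -> : Q.[phi z] = (zeros_poly zeta m).[phi z] *
    \prod_(j < n | `[< index_J u phi zeta m j >])
      (phi z - lim (phi @ nontangential (zeta j))) ^+ m j.
  rewrite /Q hornerM; congr (_ * _); rewrite horner_prod; apply: eq_bigr => j _.
  by rewrite horner_exp hornerXsubC.
rewrite (hornerM _ _ z) horner_exp hornerXsubC invfM -(subnK (ltnW km)) exprD addnK.
have := disk_neq (zeta1 i) zd; set x := z - zeta i => x0.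
set P := \prod_(_ < _ | _) _; set A := (zeros_cofactor _ _ _).[z].
have -> : (x ^+ (m i - k) * x ^+ k)^-1 = (x ^+ k)^-1 * (x ^+ (m i - k))^-1.
  by rewrite invfM mulrC.
have xk : (x ^+ (m i - k))^-1 * x ^+ (m i - k) = 1 by rewrite mulVf// expf_neq0.
transitivity (u z / x ^+ k * ((zeros_poly zeta m).[phi z] * P / A) *
   ((x ^+ (m i - k))^-1 * x ^+ (m i - k))); first by ring.
by rewrite xk mulr1.
Qed.

(** For [j] in [J] the limit of [phi] at [zeta j] lies in the open disk, so it differs from the
    unimodular [v]. *)
Lemma weight_numerator_neq0 v : `|v| = 1 -> (zeros_poly zeta m).[v] != 0 ->
  Q.[v] != 0.
Proof.
move=> v1 av; rewrite /Q hornerM mulf_neq0// horner_prod.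
apply/prodf_neq0 => j /asboolP[_ [x phix x1]].
rewrite horner_exp hornerXsubC (nontangential_lim (zeta1 j) phix) expf_neq0//.
by rewrite subr_eq0; apply/eqP => vx; move: x1; rewrite /disk /= -vx v1 ltxx.
Qed.

(** Otherwise [W] would have two limits at [zeta i]: the nonzero [L], and [0] by the growth bound
    for [H^2]. *)
Lemma zeros_poly_unimodular_limit i k v q F : (k < m i)%N ->
  flat (zeta i) (m i) F ->
  (forall z, disk z -> u z = F z + (q * ('X - (zeta i)%:P) ^+ k).[z]) ->
  q.[zeta i] != 0 -> phi @ nontangential (zeta i) --> v -> `|v| = 1 ->
  hardy2 (weight_w u phi zeta m) -> (zeros_poly zeta m).[v] = 0.
Proof.
move=> km flatF uE q0 phiv v1 /(@hardy2_flat _ (zeta i))[G [[G0 _] /(_ 0%N) wG]].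
apply/eqP; apply: contraT => /(weight_numerator_neq0 v1) Qv.
have A0 := zeros_cofactor_neq0 m zeta_inj i.
have uk := flat_add_poly_cvg (q := q) (zeta1 i) km flatF.
have QA : Q.[phi z] / (zeros_cofactor zeta m i).[z] @[z --> nontangential (zeta i)]
    --> Q.[v] / (zeros_cofactor zeta m i).[zeta i].
  exact: (cvgM (horner_cvg (q := Q) _ phiv)
    (cvgV A0 (horner_nontangential (q := zeros_cofactor zeta m i)))).
pose L := q.[zeta i] * (Q.[v] / (zeros_cofactor zeta m i).[zeta i]).
pose W z := weight_w u phi zeta m z * (z - zeta i) ^+ (m i - k).
have WL : W @ nontangential (zeta i) --> L.
  apply: (@eq_disk_cvg _ (fun z =>
    (F z + (q * ('X - (zeta i)%:P) ^+ k).[z]) / (z - zeta i) ^+ k *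
    (Q.[phi z] / (zeros_cofactor zeta m i).[z]))); last exact: cvgM uk QA.
  by move=> z zd; rewrite /W (weight_wE km zd) uE.
have W0 : W @ nontangential (zeta i) --> (0 : C).
  (* One of the [m i - k] factors, at least one in number, offsets the growth of [w]; the others
     form a polynomial. *)
  apply: (@eq_disk_cvg _ (fun z =>
    G 0%N z * (z - zeta i) ^+ 1 / (z - zeta i) ^+ 0 *
    (('X - (zeta i)%:P) ^+ (m i - k.+1)).[z])); last first.
    exact: cvg_mul0 wG (horner_nontangential (q := ('X - (zeta i)%:P) ^+ (m i - k.+1))).
  move=> z zd; rewrite /W G0// horner_exp hornerXsubC divr1 expr1 -mulrA -exprS.
  by rewrite subnSK.
have L0 : L = 0 := cvg_nontangential_unique (zeta1 i) WL W0.
by move: L0 => /eqP; rewrite !mulf_eq0 invr_eq0 (negbTE q0) (negbTE Qv) (negbTE A0).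
Qed.

End Weight.
End Limits.

Theorem theorem4p2 (R : realType) (b mate : R[i]^o -> R[i]^o)
    (pb qb pm qm : {poly R[i]^o})
    (n : nat) (zeta : 'I_n -> R[i]^o) (m : 'I_n -> nat)
    (u phi : R[i]^o -> R[i]^o)
    (b_hardyoo : hardyoo b)
    (b_norm : hinf_norm b = 1%E)
    (b_rational : rational_on_disk b pb qb)
    (b_not_blaschke : ~ finite_blaschke b)
    (mate_b : pythagorean_mate b mate)
    (mate_rational : rational_on_disk mate pm qm)
    (n_gt0 : (0 < n)%N)
    (mate_zeros : circle_zeros pm zeta m)
    (u_analytic : analytic u)
    (phi_analytic : analytic phi)
    (phi_disk : forall z, disk z -> disk (phi z))
    (u_Hb : de_branges_rovnyak zeta m u)
    (uphi_Hb : de_branges_rovnyak zeta m (fun z => u z * phi z))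
    (w_H2 : hardy2 (weight_w u phi zeta m)) :
  forall i : 'I_n,
    (forall l : nat, (l < m i)%N -> bderiv_eq0 u l (zeta i)) \/
    ((exists2 l : nat, (l < m i)%N & bderiv_neq0 u l (zeta i)) /\
     (exists2 v : R[i]^o, phi @ nontangential (zeta i) --> v &
        disk v \/ exists j : 'I_n, v = zeta j)).
Proof.
have [zeta_inj zetaP _] := mate_zeros.
have zeta1 j : `|zeta j| = 1 by have [] := (zetaP (zeta j)).2 (ex_intro _ j erefl).
move=> i.
have [F [p [flatF uE]]] := de_branges_rovnyak_flat zeta1 i u_Hb.
have [H [p' [flatH uphiE]]] := de_branges_rovnyak_flat zeta1 i uphi_Hb.
have u_deriv l (lm : (l < m i)%N) :=
  derive1n_flat_add_poly_cvg (zeta1 i) lm flatF uE.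
(* The order [k] of [p] at [zeta i] decides the alternative: the boundary derivatives below [m i]
   all vanish if [p = 0] or [m i <= k]; otherwise the one of order [k] is [k!] times the nonzero
   [q.[zeta i]]. *)
have [k [q]] := multiplicity_XsubC p (zeta i).
have [p0 _ _|p0 /= q0 pE] := eqVneq p 0.
  left=> l lm; have := u_deriv l lm; rewrite p0.
  by rewrite [_^`(l)]linear0 horner0.
have [mk|km] := leqP (m i) k.
  left=> l lm; have := u_deriv l lm; rewrite pE.
  rewrite horner_derivn_mulXsubC; last exact: leq_trans (ltnW lm) mk.
  by rewrite (ltn_eqF (leq_trans lm mk)).
have qz0 : q.[zeta i] != 0 by [].
right; split.
  exists k => //; exists p^`(k).[zeta i]; first exact: u_deriv.
  by rewrite pE horner_derivn_mulXsubC// eqxx mulf_neq0// pnatr_eq0 -lt0n.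
rewrite pE in uE.
have FH z : disk z ->
    (F z + (q * ('X - (zeta i)%:P) ^+ k).[z]) * phi z = H z + p'.[z].
  by move=> zd; rewrite -uE// -uphiE.
have [v phiv] := bounded_quotient_limit (zeta1 i) km phi_disk flatF flatH qz0 FH.
rewrite le_eqVlt => /predU1P[v1|vd]; exists v => //; last by left.
right; apply: zeros_poly_eq0.
exact: (zeros_poly_unimodular_limit zeta_inj zeta1 km flatF uE qz0 phiv v1 w_H2).
Qed.
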